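(* Let $t\in\mathbb{Z}_+$ and $\alpha\in(0,1)$. Let $\mathcal{Q}_1,\dots,\mathcal{Q}_t$ be probability distributions on $\mathbb{R}$ with continuous CDFs $F_1,\dots,F_t$, and let $\mathcal{D}_1,\dots,\mathcal{D}_t$ be independent datasets, where $\mathcal{D}_j=\{u_{j,i}\}_{i=1}^{B_j}$ consists of $B_j\ge1$ i.i.d. samples from $\mathcal{Q}_j$. Choose $\delta\in(0,1)$ and set $\delta'=\delta/(4t^2)$. Let $\widehat{k}$ be any element of $\mathop{\mathrm{argmin}}_{k\in\{1,\dots,t\}}\{\widehat{\phi}(t,k,\delta')+\psi(t,k,\delta')\}$ (this is the output window of the adaptive rolling window algorithm, which returns $\widehat{q}_{t,\widehat{k}}$). Then with probability at least $1-\delta$, $$\big|F_t(\widehat{q}_{t,\widehat{k}})-(1-\alpha)\big|\lesssim \min_{k\in\{1,\dots,t\}}\{\phi(t,k)+\psi(t,k,\delta')\}\lesssim\min_{k\in\{1,\dots,t\}}\Big\{\phi(t,k)+\sqrt{\tfrac{\alpha(1-\alpha)}{B_{t,k}}}+\tfrac{1}{B_{t,k}}\Big\},$$ where $\lesssim$ means inequality up to a multiplicative factor that is a universal constant times a logarithmic factor in $t$ and $\delta^{-1}$.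
   Context: For a CDF $F$ and $\gamma\in(0,1)$, the left $\gamma$-quantile is $\mathsf{Q}^-_\gamma(F)=\inf\{x\in\mathbb{R}:F(x)\ge\gamma\}$. For $m\in\{1,\dots,t\}$ let $B_{t,m}=\sum_{j=t-m+1}^t B_j$, $\widehat{F}_{t,m}(x)=\frac{1}{B_{t,m}}\sum_{j=t-m+1}^t\sum_{l=1}^{B_j}\mathbf{1}\{x\ge u_{j,l}\}$, $\widehat{q}_{t,m}=\mathsf{Q}^-_{1-\alpha}(\widehat{F}_{t,m})$, $\phi(t,m)=\max_{t-m+1\le j\le t}\|F_j-F_t\|_\infty$, and $\psi(t,m,\delta)=\frac{5}{4}\sqrt{\frac{2\alpha(1-\alpha)\log(2/\delta)}{B_{t,m}}}+\frac{4\log(2/\delta)}{B_{t,m}}$. The bias proxy is $$\widehat{\phi}(t,k,\delta)=\frac{5}{12}\max_{i\in\{1,\dots,k\}}\Big(\big|\widehat{F}_{t,i}(\widehat{q}_{t,k})-(1-\alpha)\big|-\Big[\tfrac{6}{5}\psi(t,k,\delta/2)+\tfrac{4}{5}\psi(t,i,\delta/2)\Big]\Big)_+ ,$$ where $x_+=\max\{x,0\}$. *)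

(* Defs.v *)
From mathcomp Require Import all_boot all_order all_algebra.
From mathcomp Require Import all_classical all_reals all_analysis.
Set Implicit Arguments. Unset Strict Implicit. Unset Printing Implicit Defensive.
Import Order.TTheory GRing.Theory Num.Theory.
Local Open Scope classical_set_scope.
Local Open Scope ring_scope.

Section Defs.
Variable R : realType.

Definition lquantile (F : R -> R) (gamma : R) : R := inf [set x : R | gamma <= F x].

Definition Bwin (B : nat -> nat) (t m : nat) : nat := (\sum_(t.+1 - m <= j < t.+1) B j)%N.

Definition Fhat (B : nat -> nat) (u : nat -> nat -> R) (t m : nat) (x : R) : R :=
  (Bwin B t m)%:R^-1 *
  \sum_(t.+1 - m <= j < t.+1) \sum_(1 <= l < (B j).+1) (u j l <= x)%R%:R.

Definition qhat (alpha : R) (B : nat -> nat) (u : nat -> nat -> R) (t m : nat) : R :=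
  lquantile (Fhat B u t m) (1 - alpha).

Definition phi (F : nat -> R -> R) (t m : nat) : R :=
  \big[Num.max/0]_(t.+1 - m <= j < t.+1) sup (range (fun x => `|F j x - F t x|)).

Definition psi (alpha : R) (B : nat -> nat) (t m : nat) (delta : R) : R :=
  5 / 4 * Num.sqrt (2 * alpha * (1 - alpha) * ln (2 / delta) / (Bwin B t m)%:R)
  + 4 * ln (2 / delta) / (Bwin B t m)%:R.

Definition phihat (alpha : R) (B : nat -> nat) (u : nat -> nat -> R)
    (t k : nat) (delta : R) : R :=
  5 / 12 * \big[Num.max/0]_(1 <= i < k.+1)
    Num.max 0 (`|Fhat B u t i (qhat alpha B u t k) - (1 - alpha)|
                - (6 / 5 * psi alpha B t k (delta / 2) + 4 / 5 * psi alpha B t i (delta / 2))).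

Definition min_1_to (t : nat) (f : nat -> R) : R :=
  \big[Num.min/f 1%N]_(1 <= k < t.+1) f k.

End Defs.

Definition mutually_independent {d} {T : measurableType d} {R : realType}
    (P : probability T R) {I : eqType} (D : set I) (X : I -> T -> R) : Prop :=
  forall (s : seq I), uniq s -> (forall i, i \in s -> D i) ->
  forall (A : I -> set R), (forall i, measurable (A i)) ->
  P (\big[setI/setT]_(i <- s) (X i @^-1` A i)) =
  (\prod_(i <- s) P (X i @^-1` A i))%E.

(* Main.v *)
Require Import Defs.
From mathcomp Require Import all_boot all_order all_algebra.
From mathcomp Require Import all_classical all_reals all_analysis.
From mathcomp Require Import measurable_realfun ring lra.
Import Order.TTheory GRing.Theory Num.Theory.
Import numFieldNormedType.Exports.
Local Open Scope classical_set_scope.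
Local Open Scope ring_scope.
Set Implicit Arguments. Unset Strict Implicit.

(* Write p = 1 - alpha and D_k = phi(t,k) + psi(t,k,delta'/2).  By continuity, F_t
   takes the values p +- 2 D_k and p +- 13 D_k at deterministic points, and there
   Bernstein's inequality for independent indicators controls every empirical CDF
   Fhat_{t,i}; its variance term is alpha(1-alpha) up to an error absorbed by the
   distance of the level to p plus phi(t,i).  The 4t levels, t windows and two
   tails account for delta' = delta/(4t^2).

   Monotonicity carries the control over to random points.  The points at levels
   p +- 2 D_k bracket qhat_{t,k}, which yields |F_t(qhat_{t,k}) - p| <= 2 D_k and
   phihat(t,k) <= 2 D_k, so the objective at k is at most 3 D_k.  Compare khat with
   any k.  If khat <= k, use the bracket of khat and the monotonicity of phi.  If
   k < khat, then i = k is allowed in phihat(t,khat), so Fhat_{t,k} at the selected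
   quantile is within 8 D_k of p, and the points at levels p +- 13 D_k turn this
   into a bound on F_t there. *)

(** * Exponential inequalities and the Bernoulli moment generating function *)

Section expR_bounds.
Variable R : realType.
Implicit Types x y : R.

(** The function [h] equals 1 at 0, and its derivative [expR y * (y ^+ 2 / 2)] is nonnegative. *)
Lemma expRN_le_quadratic x : 0 <= x -> expR (- x) <= 1 - x + x ^+ 2 / 2.
Proof.
move=> x0; pose h (y : R) := expR y * (1 - y + y ^+ 2 / 2).
have dh (y : R) : is_derive y 1 h (expR y * (y ^+ 2 / 2)).
  apply: is_derive_eq; rewrite !scaler1 /GRing.scale /=; by field.
have : h 0 <= h x.
  apply: (@ger0_derive1_le_cc _ h 0 x) => //.
  - by move=> y _; rewrite derive1E (@derive_val _ _ _ _ _ _ _ (dh y)) mulr_ge0 ?expR_ge0// divr_ge0// sqr_ge0.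
  - by apply: derivable_within_continuous => y _; apply: ex_derive; exact: dh.
  - by rewrite in_itv/= lexx x0.
  - by rewrite in_itv/= lexx x0.
rewrite /h expR0 expr0n/= mul0r subr0 addr0 mul1r => h1.
by rewrite expRN -[leLHS]mulr1 ler_pdivrMl ?expR_gt0// .
Qed.

(** Multiplying by [1 - x] reduces the claim to [h x <= h 0]; the derivative of [h] is
    [- y * (expR y - 1)], negative for positive [y]. *)
Lemma expR_le_bernstein x : 0 <= x < 1 -> expR x <= 1 + x + x ^+ 2 / 2 / (1 - x).
Proof.
move=> /andP[x0 x1]; pose h (y : R) := expR y * (1 - y) + y ^+ 2 / 2.
have dh (y : R) : is_derive y 1 h (- y * (expR y - 1)).
  apply: is_derive_eq; rewrite !scaler1 /GRing.scale /=; by field.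
have : h x <= h 0.
  apply: (@ler0_derive1_le_cc _ h 0 x) => //.
  - move=> y; rewrite in_itv/= => /andP[y0 _]; rewrite derive1E (@derive_val _ _ _ _ _ _ _ (dh y)) mulNr oppr_le0.
    by rewrite mulr_ge0 ?ltW// subr_gt0 expR_gt1.
  - by apply: derivable_within_continuous => y _; apply: ex_derive; exact: dh.
  - by rewrite in_itv/= lexx x0.
  - by rewrite in_itv/= lexx x0.
rewrite /h expR0 expr0n/= mul0r subr0 addr0 mul1r => h1.
have xx : 0 < 1 - x by lra.
rewrite -(ler_pM2r xx) mulrDl divfK ?gt_eqF//; lra.
Qed.

(** The two bounds above are applied at the values [- p] and [1 - p] of a centred Bernoulli
    variable. The linear terms cancel, the quadratic ones add up to [p * (1 - p) * b], and
    [1 + v * b <= expR (v * b)] concludes. *)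
Lemma bernoulli_mgf_le (p l v : R) : 0 <= p <= 1 -> p * (1 - p) <= v -> 0 <= l < 1 ->
  1 + (expR l - 1) * p <= expR (l * p + v * (l ^+ 2 / 2 / (1 - l))).
Proof.
move=> /andP[p0 p1] pv /andP[l0 l1].
have l1' : 0 < 1 - l by lra.
set b := l ^+ 2 / 2 / (1 - l).
have b0 : 0 <= b by rewrite /b !divr_ge0 ?sqr_ge0 ?ltW.
have e1 : expR (- (l * p)) <= 1 - l * p + p ^+ 2 * b.
  apply: (le_trans (expRN_le_quadratic _)); first exact: mulr_ge0.
  rewrite lerD2l.
  have -> : p ^+ 2 * b = (l * p) ^+ 2 / 2 / (1 - l) by rewrite /b; field; lra.
  by rewrite ler_pdivlMr// ler_piMr ?divr_ge0 ?sqr_ge0//; lra.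
have e2 : expR (l * (1 - p)) <= 1 + l * (1 - p) + (1 - p) ^+ 2 * b.
  apply: (le_trans (expR_le_bernstein _)).
    rewrite mulr_ge0 ?subr_ge0//=; apply: le_lt_trans l1; nra.
  rewrite lerD2l.
  have -> : (1 - p) ^+ 2 * b = (l * (1 - p)) ^+ 2 / 2 / (1 - l) by rewrite /b; field; lra.
  by rewrite ler_wpM2l ?divr_ge0 ?sqr_ge0// lef_pV2 ?posrE//; nra.
rewrite expRD -ler_pdivrMl ?expR_gt0// -expRN.
apply: (@le_trans _ _ (1 + v * b)); last exact: expR_ge1Dx.
have -> : expR (- (l * p)) * (1 + (expR l - 1) * p)
   = (1 - p) * expR (- (l * p)) + p * expR (l * (1 - p)).
  have -> : l * (1 - p) = l - l * p by ring.
  by rewrite expRD; ring.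
have f1 := ler_wpM2l p0 e2.
have f2 := ler_wpM2l (_ : 0 <= 1 - p) e1.
have {f2} := f2 ltac:(lra) => f2.
have f3 := ler_wpM2r b0 pv.
nra.
Qed.

End expR_bounds.

(** * Chernoff's bound for sums of independent indicators *)

Section independent_events.
Context d (T : measurableType d) (R : realType) (P : probability T R) (I : eqType).
Variables (A : I -> set T) (p : I -> R).

(** Singletons identify [p i] as the probability of [A i]; quantifying over all duplicate-free lists
    drawn from [s] makes the property pass to sublists. *)
Definition independent_on (s : seq I) := forall s' : seq I, uniq s' -> {subset s' <= s} ->
  P (\big[setI/setT]_(i <- s') A i) = (\prod_(i <- s') p i)%:E.

Hypothesis mA : forall i, measurable (A i).

Lemma measurable_prod_indic (c : R) (s : seq I) :
  measurable_fun setT (fun w => \prod_(i <- s) (1 + c * \1_(A i) w) : R).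
Proof.
apply: measurable_prod => i _; apply: measurable_funD => //.
by apply: measurable_funM => //; exact: measurable_indic.
Qed.

Lemma measurable_sum_indic_ge (m : R) (s : seq I) :
  measurable [set w | m <= \sum_(i <- s) \1_(A i) w].
Proof.
set S := [set w | _].
have -> : S = setT `&` (fun w => \sum_(i <- s) \1_(A i) w) @^-1` `[m, +oo[%classic.
  by rewrite setTI; apply/seteqP; split=> w; rewrite /S/= in_itv/= andbT.
suff : measurable_fun setT (fun w => \sum_(i <- s) \1_(A i) w : R) by apply.
by apply: measurable_sum => i; exact: measurable_indic.
Qed.

Lemma measurable_big_setI (s : seq I) : measurable (\big[setI/setT]_(i <- s) A i).
Proof. by elim/big_ind: _ => // *; exact: measurableI. Qed.

(* The accumulated intersection over [s1] is what makes the induction on [s2] go through. *)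
Lemma expectation_prod_indic_aux (c : R) (s1 s2 : seq I) : 0 <= c ->
  uniq (s1 ++ s2) -> independent_on (s1 ++ s2) ->
  (\int[P]_w (\1_(\big[setI/setT]_(i <- s1) A i) w
              * \prod_(i <- s2) (1 + c * \1_(A i) w))%:E
  = (\prod_(i <- s1) p i * \prod_(i <- s2) (1 + c * p i))%:E)%E.
Proof.
move=> c0; elim: s2 s1 => [|j s2 IH] s1 us ind.
  under eq_integral do rewrite big_nil mulr1.
  rewrite integral_indic ?setIT//; last exact: measurable_big_setI.
  rewrite big_nil mulr1; apply: ind; first by rewrite cats0 in us.
  by move=> i; rewrite cats0.
have pr0 w : 0 <= \prod_(i <- s2) (1 + c * \1_(A i) w).
  by apply: prodr_ge0 => i _; rewrite addr_ge0// mulr_ge0.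
have perm : perm_eq (s1 ++ j :: s2) ((j :: s1) ++ s2) by rewrite -cat1s perm_catCA.
transitivity (\int[P]_w ((\1_(\big[setI/setT]_(i <- s1) A i) w
              * \prod_(i <- s2) (1 + c * \1_(A i) w))%:E
    + c%:E * (\1_(\big[setI/setT]_(i <- j :: s1) A i) w
              * \prod_(i <- s2) (1 + c * \1_(A i) w))%:E))%E.
  apply: eq_integral => w _; rewrite -EFinM -EFinD !big_cons; congr EFin.
  by rewrite indicI /=; ring.
rewrite ge0_integralD//; first last.
- apply/measurable_EFinP; apply: measurable_funM => //; apply: measurable_funM.
    by apply: measurable_indic; exact: measurable_big_setI.
  exact: measurable_prod_indic.
- by move=> w _; rewrite -EFinM lee_fin !mulr_ge0.
- apply/measurable_EFinP; apply: measurable_funM; last exact: measurable_prod_indic.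
  by apply: measurable_indic; exact: measurable_big_setI.
- by move=> w _; rewrite lee_fin mulr_ge0.
rewrite ge0_integralZl//; first last.
- by move=> w _; rewrite lee_fin mulr_ge0.
- apply/measurable_EFinP; apply: measurable_funM; last exact: measurable_prod_indic.
  by apply: measurable_indic; exact: measurable_big_setI.
rewrite IH; last 2 first.
- by move: us; rewrite (perm_uniq perm) => /andP[].
- by move=> s' us' ss'; apply: ind => // i /ss'; rewrite (perm_mem perm) inE => ->; rewrite orbT.
rewrite IH; last 2 first.
- by rewrite -(perm_uniq perm).
- by move=> s' us' ss'; apply: ind => // i /ss'; rewrite (perm_mem perm).
by rewrite -EFinM -EFinD !big_cons; congr EFin; ring.
Qed.

Lemma expectation_prod_indic (c : R) (s : seq I) : 0 <= c -> uniq s -> independent_on s ->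
  (\int[P]_w (\prod_(i <- s) (1 + c * \1_(A i) w))%:E
   = (\prod_(i <- s) (1 + c * p i))%:E)%E.
Proof.
move=> c0 us ind.
have := @expectation_prod_indic_aux c [::] s c0 us ind; rewrite !big_nil !mul1r => <-.
by apply: eq_integral => w _; rewrite indicT mul1r.
Qed.

(** Markov's inequality for the exponential of [l] times the count. Indicators being 0 or 1, this
    exponential is a product of factors affine in them, whose expectation is
    [expectation_prod_indic]. *)
Lemma chernoff_indic (l m : R) (s : seq I) : 0 <= l -> uniq s -> independent_on s ->
  (P [set w | m <= \sum_(i <- s) \1_(A i) w]%R
   <= (expR (- (l * m)) * \prod_(i <- s) (1 + (expR l - 1) * p i))%:E)%E.
Proof.
move=> l0 us ind.
have c0 : 0 <= expR l - 1 by rewrite subr_ge0 -expR0 ler_expR.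
set S := [set w | _].
have mS : measurable S by exact: measurable_sum_indic_ge.
have eS w : expR (l * \sum_(i <- s) \1_(A i) w) = \prod_(i <- s) (1 + (expR l - 1) * \1_(A i) w).
  rewrite mulr_sumr expR_sum; apply: eq_bigr => i _; rewrite indicE.
  by case: (_ \in _) => /=; rewrite ?mulr1 ?mulr0 ?expR0 ?addr0// addrC subrK.
rewrite EFinM -(expectation_prod_indic c0 us ind) -ge0_integralZl//; last 2 first.
- by apply/measurable_EFinP; exact: measurable_prod_indic.
- by move=> w _; rewrite lee_fin -eS expR_ge0.
rewrite -[X in P X]setIT -integral_indic//; apply: ge0_le_integral => //.
- by apply/measurable_EFinP; exact: measurable_indic.
- apply/measurable_EFinP; apply: measurable_funM => //; exact: measurable_prod_indic.
move=> w _; rewrite -EFinM lee_fin -eS -expRD indicE.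
case: (boolP (w \in S)) => [|_]; rewrite ?expR_ge0//.
rewrite inE /S/= => mw; rewrite -[leLHS]expR0 ler_expR addrC subr_ge0.
exact: ler_wpM2l.
Qed.
End independent_events.

(** * Bernstein's inequality for independent indicators *)

Section bernstein.
Context d (T : measurableType d) (R : realType) (P : probability T R) (I : eqType).
Variables (A : I -> set T) (p : I -> R).
Hypothesis mA : forall i, measurable (A i).

Lemma bernstein_indic (v x : R) (s : seq I) : 0 < v -> 0 < x -> (0 < size s)%N ->
  uniq s -> independent_on P A p s ->
  (forall i, i \in s -> 0 <= p i <= 1) -> (forall i, i \in s -> p i * (1 - p i) <= v) ->
  (P [set w | \sum_(i <- s) p i + (Num.sqrt (2 * v * x * (size s)%:R) + x)
              <= \sum_(i <- s) \1_(A i) w]%R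
   <= (expR (- x))%:E)%E.
Proof.
move=> v0 x0 s0 us ind p01 pv.
set W := (size s)%:R * v.
have W0 : 0 < W by rewrite mulr_gt0// ltr0n.
set r := Num.sqrt (2 * x / W).
have r0 : 0 <= r by exact: sqrtr_ge0.
have r2 : r ^+ 2 * W = 2 * x.
  rewrite sqr_sqrtr ?divfK ?gt_eqF//.
  by apply: divr_ge0; [lra|exact: ltW].
have -> : Num.sqrt (2 * v * x * (size s)%:R) = r * W.
  rewrite -[RHS](ger0_norm (mulr_ge0 r0 (ltW W0))) -sqrtr_sqr.
  congr Num.sqrt.
  by rewrite exprMn (expr2 W) mulrA r2 /W; ring.
(* With this choice [1 - l] is [1 / (1 + r)], the variance term becomes [x / (1 + r)], and the total
   exponent is exactly [- x]. *)
pose l := r / (1 + r).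
have r1 : 0 < 1 + r by lra.
have l01 : 0 <= l < 1 by apply/andP; rewrite /l ltr_pdivrMr// divr_ge0//; lra.
have /andP[l0 _] := l01.
apply: (le_trans (chernoff_indic mA _ l0 us ind)); rewrite lee_fin.
apply: (@le_trans _ _ (expR (- (l * (\sum_(i <- s) p i + (r * W + x))))
   * expR (\sum_(i <- s) (l * p i + v * (l ^+ 2 / 2 / (1 - l)))))).
  rewrite ler_wpM2l ?expR_ge0// expR_sum big_seq [leRHS]big_seq.
  apply: ler_prod => i si; rewrite bernoulli_mgf_le ?p01 ?pv// andbT.
  have /andP[p0 _] := p01 _ si.
  by rewrite addr_ge0// mulr_ge0// subr_ge0 -expR0 ler_expR.
rewrite -expRD ler_expR big_split/= -mulr_sumr big_const_seq count_predT iter_addr_0.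
have -> : (v * (l ^+ 2 / 2 / (1 - l))) *+ size s = x / (1 + r).
  have -> : x = r ^+ 2 * W / 2 by rewrite r2; field.
  rewrite -mulr_natl /W /l; field; apply/andP; split; rewrite gt_eqF//; lra.
have r1_neq0 : 1 + r != 0 by rewrite gt_eqF.
have e : - (l * (\sum_(i <- s) p i + (r * W + x))) + (l * (\sum_(i <- s) p i) + x / (1 + r))
   = - ((r ^+ 2 * W + r * x) - x) / (1 + r) by rewrite /l; field.
by rewrite e r2 ler_pdivrMr//; lra.
Qed.
End bernstein.

(** * Windows of sample indices *)

Section windows.
Variables (R : realType) (B : nat -> nat) (t : nat).

(** A flat list of index pairs, so that Bernstein's inequality applies to the whole double sum at
    once. *)
Definition window (m : nat) : seq (nat * nat) :=
  [seq (j, l) | j <- index_iota (t.+1 - m) t.+1, l <- index_iota 1 (B j).+1].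

Lemma mem_window m j l :
  ((j, l) \in window m) = (t < j + m)%N && (j <= t)%N && (1 <= l <= B j)%N.
Proof.
apply/allpairsPdep/idP => [[j' [l' []]]|/andP[/andP[mj jt] lB]].
  rewrite !mem_index_iota => mj lB [-> ->].
  by move: mj lB; rewrite !ltnS leq_subLR addnC => /andP[-> ->] ->.
by exists j, l; rewrite !mem_index_iota !ltnS leq_subLR addnC mj jt lB.
Qed.

Lemma window_uniq m : uniq (window m).
Proof.
apply: allpairs_uniq_dep; first exact: iota_uniq.
  by move=> j _; exact: iota_uniq.
by move=> [j l] [j' l'] _ _ /= [-> ->].
Qed.

Lemma big_window m (f : nat * nat -> R) :
  \sum_(jl <- window m) f jl =
  \sum_(t.+1 - m <= j < t.+1) \sum_(1 <= l < (B j).+1) f (j, l).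
Proof. by rewrite big_allpairs_dep. Qed.

Lemma size_window m : size (window m) = Bwin B t m.
Proof.
rewrite size_allpairs_dep sumnE big_map /Bwin.
by apply: eq_bigr => j _; rewrite size_iota subn1.
Qed.

Lemma FhatE (u : nat -> nat -> R) m x : Fhat B u t m x =
  (\sum_(jl <- window m) (u jl.1 jl.2 <= x)%R%:R) / (Bwin B t m)%:R.
Proof. by rewrite /Fhat big_window mulrC. Qed.

Hypothesis B_gt0 : forall j, (1 <= j <= t)%N -> (1 <= B j)%N.

Lemma Bwin_gt0 m : (1 <= m <= t)%N -> (0 < Bwin B t m)%N.
Proof.
move=> /andP[m0 mt]; rewrite -size_window -has_predT; apply/hasP.
exists (t, 1)%N => //; rewrite mem_window leqnn ltnNge -{2}[t]addn0 leq_add2l -ltnNge m0.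
by rewrite leqnn B_gt0// leqnn (leq_trans m0).
Qed.

End windows.

(** * The Bernstein deviation in terms of [psi] *)

Section psi_bounds.
Variables (R : realType) (alpha : R) (B : nat -> nat) (t m : nat).
Hypothesis alpha01 : 0 < alpha < 1.
Hypothesis N_gt0 : (0 < Bwin B t m)%N.
Let N : R := (Bwin B t m)%:R.

(** The factor 4/5 undoes the 5/4 in [psi]. With [x] the logarithm, the excess variance [h] costs
    [Num.sqrt (2 * h * x * N) <= N * h / 4 + 2 * x] by AM-GM, and the total [3 * x] fits into the
    available [16 / 5 * x]. *)
Lemma bernstein_dev_le_psi (h delta : R) : 0 <= h -> 0 < delta < 2 ->
  Num.sqrt (2 * (alpha * (1 - alpha) + h) * ln (2 / delta) * N) + ln (2 / delta)
  <= N * (4 / 5 * psi alpha B t m delta + h / 4).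
Proof.
move=> h0 /andP[d0 d2].
have N0 : 0 < N by rewrite ltr0n.
have /andP[a0 a1] := alpha01.
have x0 : 0 < ln (2 / delta) by rewrite ln_gt0// ltr_pdivlMr// mul1r.
rewrite /psi -/N; set x := ln _ in x0 *.
set s := Num.sqrt (2 * alpha * _ * _ / _).
have s0 : 0 <= s by exact: sqrtr_ge0.
have s2 : s ^+ 2 * N = 2 * alpha * (1 - alpha) * x.
  rewrite sqr_sqrtr ?divfK ?gt_eqF//.
  by rewrite divr_ge0 ?(ltW N0)// !mulr_ge0//; lra.
have y0 : 0 <= N * s + (N * h / 4 + 2 * x).
  by rewrite !addr_ge0// ?divr_ge0// ?mulr_ge0//; lra.
have -> : N * (4 / 5 * (5 / 4 * s + 4 * x / N) + h / 4) = N * s + (N * h / 4 + 2 * x) + 6 / 5 * x.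
  by field; rewrite gt_eqF.
have le1 : Num.sqrt (2 * (alpha * (1 - alpha) + h) * x * N) <= N * s + (N * h / 4 + 2 * x).
  rewrite -[leRHS]ger0_norm// -sqrtr_sqr ler_wsqrtr//.
  have c0 : 0 <= (N * h / 4) * (N * s) by rewrite !mulr_ge0//; lra.
  have c1 : 0 <= (2 * x) * (N * s) by rewrite !mulr_ge0//; lra.
  have c2 := sqr_ge0 (N * h / 4 - 2 * x).
  have e : (N * s) ^+ 2 = 2 * alpha * (1 - alpha) * x * N by rewrite -s2; ring.
  by nra.
by lra.
Qed.

End psi_bounds.

Lemma indic_preimage {T : Type} {R : realType} (X : T -> R) (i : interval R) w :
  \1_(X @^-1` [set` i]) w = (X w \in i)%:R :> R.
Proof. by rewrite indicE; congr (_%:R); congr nat_of_bool; apply/idP/idP; rewrite inE. Qed.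

(** * Concentration of the empirical CDFs at a deterministic point *)

Section fixed_point_concentration.
Context d (T : measurableType d) (R : realType) (P : probability T R).
Variables (t : nat) (alpha delta : R) (B : nat -> nat) (F : nat -> R -> R).
Variable u : nat -> nat -> {RV P >-> R}.
Hypothesis alpha01 : 0 < alpha < 1.
Hypothesis delta02 : 0 < delta < 2.
Hypothesis B_gt0 : forall j, (1 <= j <= t)%N -> (1 <= B j)%N.
Hypothesis cdf_u : forall j l, (1 <= j <= t)%N -> (1 <= l <= B j)%N ->
     forall x, cdf (u j l) x = (F j x)%:E.
Hypothesis u_indep : mutually_independent P
    (fun jl : nat * nat => (1 <= jl.1 <= t)%N /\ (1 <= jl.2 <= B jl.1)%N)
    (fun jl => (u jl.1 jl.2 : T -> R)).

Let Fh m z w := Fhat B (fun j l => u j l w) t m z.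

Lemma cdf_F_01 j z : (1 <= j <= t)%N -> 0 <= F j z <= 1.
Proof.
move=> jt; have := cdf_le1 (u j 1) z; have := cdf_ge0 (u j 1) z.
by rewrite cdf_u ?leqnn ?B_gt0// !lee_fin => -> ->.
Qed.

Lemma window_bounds m j l : (m <= t)%N -> (j, l) \in window B t m ->
  (1 <= j <= t)%N /\ (1 <= l <= B j)%N.
Proof.
move=> mt; rewrite mem_window => /andP[/andP[tj ->] ->]; split=> //; rewrite andbT.
by case: j tj => //; rewrite ltnNge mt.
Qed.

(** One form for both tails: [C] is a half-line, [q j] its probability under the j-th distribution,
    and [h] the allowed excess over the variance [alpha * (1 - alpha)]. *)
Definition exceeds m (C : set R) (q : nat -> R) (h : R) : set T :=
  [set w | \sum_(jl <- window B t m) q jl.1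
           + (Bwin B t m)%:R * (4 / 5 * psi alpha B t m delta + h / 4)
           <= \sum_(jl <- window B t m) \1_(u jl.1 jl.2 @^-1` C) w]%R.

Lemma measurable_exceeds m C q h : measurable C -> measurable (exceeds m C q h).
Proof. by move=> mC; apply: measurable_sum_indic_ge => jl; exact: measurable_funPTI. Qed.

Lemma exceeds_le m (C : set R) (q : nat -> R) (h : R) :
  measurable C -> (1 <= m <= t)%N -> 0 <= h ->
  (forall j l, (1 <= j <= t)%N -> (1 <= l <= B j)%N -> P (u j l @^-1` C) = (q j)%:E) ->
  (forall j, (1 <= j <= t)%N -> (t < j + m)%N -> q j * (1 - q j) <= alpha * (1 - alpha) + h) ->
  (P (exceeds m C q h) <= (delta / 2)%:E)%E.
Proof.
move=> mC mt h0 qP qv.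
have mt2 : (m <= t)%N by case/andP: mt.
have /andP[a0 a1] := alpha01; have /andP[d0 d2] := delta02.
have v0 : 0 < alpha * (1 - alpha) + h by rewrite ltr_pwDl// mulr_gt0// subr_gt0.
have x0 : 0 < ln (2 / delta) by rewrite ln_gt0// ltr_pdivlMr// mul1r.
have mA (jl : nat * nat) : measurable (u jl.1 jl.2 @^-1` C) by exact: measurable_funPTI.
have -> : delta / 2 = expR (- ln (2 / delta)).
  by rewrite expRN lnK ?posrE ?divr_gt0// invf_div.
have ind : independent_on P (fun jl => u jl.1 jl.2 @^-1` C) (fun jl => q jl.1) (window B t m).
  move=> s us ss; have -> := u_indep us _ (fun=> mC); last first.
    by move=> [j l] /ss /(window_bounds mt2).
  rewrite -prodEFin big_seq [RHS]big_seq; apply: eq_bigr => -[j l] /ss /(window_bounds mt2)[jt lB].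
  exact: qP.
apply: le_trans (bernstein_indic mA v0 x0 _ (window_uniq _ _ _) ind _ _).
- apply: le_measure; rewrite ?inE.
  + exact: measurable_exceeds.
  + exact: measurable_sum_indic_ge.
  move=> w; apply: le_trans; rewrite lerD2l size_window.
  by apply: bernstein_dev_le_psi => //; exact: Bwin_gt0.
- by rewrite size_window Bwin_gt0.
- move=> [j l] /(window_bounds mt2)[jt lB] /=.
  have := probability_le1 P (mA (j, l)); have := measure_ge0 P (u j l @^-1` C).
  rewrite /= qP// !lee_fin => ? ?; exact/andP.
- move=> [j l] jlw /=; have [jt lB] := window_bounds mt2 jlw; apply: qv => //.
  by move: jlw; rewrite mem_window => /andP[/andP[]].
Qed.

Definition deviates m z h := exceeds m `]-oo, z] (F^~ z) h
  `|` exceeds m `]z, +oo[ (fun j => 1 - F j z) h.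

Lemma measurable_deviates m z h : measurable (deviates m z h).
Proof. by apply: measurableU; exact: measurable_exceeds. Qed.

Lemma deviates_le m z h : (1 <= m <= t)%N ->
  (forall j, (1 <= j <= t)%N -> (t < j + m)%N -> `|F j z - (1 - alpha)| <= h) ->
  (P (deviates m z h) <= delta%:E)%E.
Proof.
move=> mt Fdev; have /andP[a0 a1] := alpha01.
have tm : (1 <= t <= t)%N /\ (t < t + m)%N.
  by case/andP: mt => m0 mt; rewrite leqnn (leq_trans m0)// -[ltnLHS]addn0 ltn_add2l.
have h0 : 0 <= h by apply: le_trans (Fdev t _ _); case: tm.
have Fv j : (1 <= j <= t)%N -> (t < j + m)%N ->
    F j z * (1 - F j z) <= alpha * (1 - alpha) + h.
  move=> jt tjm; have /andP[F0 F1] := cdf_F_01 z jt.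
  have := Fdev _ jt tjm; rewrite ler_norml => /andP[h1 h2].
  (* The last factor is at most 1 in absolute value, so the variance error is at most the distance
     of [F j z] to [1 - alpha]. *)
  have -> : F j z * (1 - F j z) = alpha * (1 - alpha) + (F j z - (1 - alpha)) * (alpha - F j z) by ring.
  rewrite lerD2l; nra.
have -> : delta = delta / 2 + delta / 2 by field.
rewrite EFinD; apply: le_trans (@measureU2 _ _ _ P _ _ _ _) _; [exact: measurable_exceeds..|].
apply: leeD; apply: exceeds_le => //.
- by move=> j l jt lB; exact: cdf_u.
- move=> j l jt lB.
  have -> : u j l @^-1` `]z, +oo[ = ~` (u j l @^-1` `]-oo, z]).
    by apply/seteqP; split=> w /=; rewrite !in_itv/= andbT real_ltNge ?num_real// => /negP.
  rewrite probability_setC; last exact: measurable_funPTI.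
  by rewrite EFinB -(cdf_u jt lB).
- by move=> j jt tjm; rewrite subKr mulrC; exact: Fv.
Qed.

(** Off the deviation event, the empirical CDF is close to the window average of the [F j z], itself
    within [f] of [c]. The lower side comes from counting the samples above [z]. *)
Lemma Fhat_near m z c f h w : (1 <= m <= t)%N ->
  (forall j, (1 <= j <= t)%N -> (t < j + m)%N -> `|F j z - c| <= f) ->
  ~ deviates m z h w ->
  `|Fh m z w - c| < f + (4 / 5 * psi alpha B t m delta + h / 4).
Proof.
move=> mt Ff /not_orP[/negP up /negP lo].
have mt2 : (m <= t)%N by case/andP: mt.
have N0 : 0 < (Bwin B t m)%:R :> R by rewrite ltr0n Bwin_gt0.
set dev := 4 / 5 * _ + _ in up lo *.
have Fw jl : jl \in window B t m -> `|F jl.1 z - c| <= f.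
  case: jl => j l jlw; have [jt _] := window_bounds mt2 jlw; apply: Ff => //.
  by move: jlw; rewrite mem_window => /andP[/andP[]].
have cst y : \sum_(jl <- window B t m) y = (Bwin B t m)%:R * y :> R.
  by rewrite big_const_seq count_predT iter_addr_0 size_window mulr_natl.
have Flo : \sum_(jl <- window B t m) F jl.1 z <= (Bwin B t m)%:R * (c + f).
  rewrite -cst big_seq [leRHS]big_seq; apply: ler_sum => jl /Fw.
  by rewrite ler_distl addrC => /andP[].
have Fup : (Bwin B t m)%:R * (c - f) <= \sum_(jl <- window B t m) F jl.1 z.
  rewrite -cst big_seq [leRHS]big_seq; apply: ler_sum => jl /Fw.
  by rewrite ler_distl => /andP[].
have FhN : Fh m z w * (Bwin B t m)%:R = \sum_(jl <- window B t m) (u jl.1 jl.2 w <= z)%R%:R.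
  by rewrite /Fh FhatE divfK// gt_eqF.
have up' : Fh m z w * (Bwin B t m)%:R < (Bwin B t m)%:R * (c + f + dev).
  rewrite mulrDr; apply: lt_le_trans (lerD Flo (lexx _)).
  rewrite FhN ltNge; apply: contra up => /le_trans; apply.
  by apply: ler_sum => jl _; rewrite indic_preimage in_itv.
have lo' : (Bwin B t m)%:R * (c - f - dev) < Fh m z w * (Bwin B t m)%:R.
  rewrite mulrBr; apply: (le_lt_trans (lerD Fup (lexx _))).
  rewrite FhN ltNge; apply: contra lo => le.
  apply: (@le_trans _ _ (\sum_(jl <- window B t m) (1 - (u jl.1 jl.2 w <= z)%R%:R))).
    by rewrite !sumrB; lra.
  apply: ler_sum => jl _; rewrite indic_preimage in_itv/= andbT ltNge.
  by case: (u _ _ _ <= z); rewrite /= ?subrr ?subr0.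
rewrite mulrC ltr_pM2l// in up'; rewrite mulrC ltr_pM2r// in lo'.
by rewrite ltr_distl; lra.
Qed.
End fixed_point_concentration.

(** * Inverting a continuous CDF, and properties of [phi] *)

Lemma cdf_surjective d (T : measurableType d) (R : realType) (P : probability T R)
    (X : {RV P >-> R}) (G : R -> R) (c : R) :
  continuous G -> (forall x, cdf X x = (G x)%:E) -> 0 < c < 1 -> exists z, G z = c.
Proof.
move=> cG GE /andP[c0 c1].
have fG : fine \o cdf X = G by apply/funext => x /=; rewrite GE.
have [a Ga] : exists a, G a < c.
  have /fine_cvg := @cvg_cdfNy0 _ _ _ P X; rewrite fG => /cvgr_lt /(_ _ c0) Hn.
  exact: (filter_ex Hn).
have [b Gb] : exists b, c < G b.
  have /fine_cvg := @cvg_cdfy1 _ _ _ P X; rewrite fG => /cvgr_gt /(_ _ c1) Hn.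
  exact: (filter_ex Hn).
have Ghomo x y : x <= y -> G x <= G y.
  by move=> xy; have := cdf_nondecreasing X xy; rewrite !GE lee_fin.
have ab : a <= b.
  by rewrite leNgt; apply/negP => /ltW /Ghomo; lra.
have [||z _ <-] := @IVT _ G a b c ab; last by exists z.
  by apply: continuous_subspaceT => x; exact: cG.
by rewrite ge_min le_max (ltW Ga) (ltW Gb) orbT.
Qed.

(** Values in [0, 1] bound the range by 1, so that [sup] is a genuine supremum and not a default
    value. *)
Lemma sup_absB_ge (R : realType) (f g : R -> R) x :
  (forall y, 0 <= f y <= 1) -> (forall y, 0 <= g y <= 1) ->
  `|f x - g x| <= sup (range (fun y => `|f y - g y|)).
Proof.
move=> f01 g01; apply: ub_le_sup; last by exists x.
exists 1 => _ [y _ <-].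
by have := f01 y; have := g01 y; rewrite ler_norml; lra.
Qed.

Section phi.
Variables (R : realType) (F : nat -> R -> R) (t : nat).

Lemma phi_ge0 m : 0 <= phi F t m.
Proof. exact: bigmax_ge_id. Qed.

Lemma phi_ge m j x : (forall j y, (1 <= j <= t)%N -> 0 <= F j y <= 1) ->
  (1 <= m)%N -> (1 <= j <= t)%N -> (t < j + m)%N -> `|F j x - F t x| <= phi F t m.
Proof.
move=> F01 m1 jt tjm; have t1 : (1 <= t <= t)%N by case/andP: jt => j0 jt; rewrite (leq_trans j0)/=.
apply: (le_trans (sup_absB_ge _ (fun y => F01 j y jt) (fun y => F01 t y t1))).
apply: (@bigmax_sup_seq _ _ _ _ _ j) => //.
by rewrite mem_index_iota ltnS leq_subLR addnC tjm; case/andP: jt.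
Qed.

Lemma phi_le k m : (k <= m)%N -> phi F t k <= phi F t m.
Proof. by move=> km; apply: le_bigmax_nat; rewrite ?leq_sub2l. Qed.
End phi.

(** * Bracketing the empirical quantile *)

Section empirical_quantile.
Variables (R : realType) (alpha : R) (B : nat -> nat) (u : nat -> nat -> R) (t m : nat).
Hypothesis alpha01 : 0 < alpha < 1.
Hypothesis N_gt0 : (0 < Bwin B t m)%N.

Lemma Fhat_nondecreasing x y : x <= y -> Fhat B u t m x <= Fhat B u t m y.
Proof.
move=> xy; rewrite !FhatE ler_wpM2r ?invr_ge0//.
apply: ler_sum => jl _; rewrite ler_nat; case: (boolP (_ <= x)) => // h.
by rewrite (le_trans h xy).
Qed.

Lemma Fhat_01 x : 0 <= Fhat B u t m x <= 1.
Proof.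
have N0 : 0 < (Bwin B t m)%:R :> R by rewrite ltr0n.
rewrite !FhatE divr_ge0 ?sumr_ge0//= ler_pdivrMr// mul1r -size_window -sum1_size natr_sum.
by apply: ler_sum => jl _; rewrite ler_nat leq_b1.
Qed.

(** Bounds from below the set whose infimum is [qhat]; [Fhat_eq1] shows that this set is
    nonempty. *)
Lemma Fhat_eq0 : exists M : R, forall x, x < M -> Fhat B u t m x = 0.
Proof.
exists (- \sum_(jl <- window B t m) `|u jl.1 jl.2|) => x xM.
rewrite FhatE big_seq big1 ?mul0r// => jl jlw.
case: (boolP (_ <= x)) => // ux; exfalso; move: xM; rewrite ltNge => /negP; apply.
apply: le_trans ux; rewrite lerNl; apply: le_trans (ler_norm _) _; rewrite normrN.
by rewrite (big_rem jl)//= lerDl sumr_ge0.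
Qed.

Lemma Fhat_eq1 : exists M : R, Fhat B u t m M = 1.
Proof.
exists (\sum_(jl <- window B t m) `|u jl.1 jl.2|).
rewrite FhatE -size_window -sum1_size natr_sum.
set S := (X in X / _); set S' := (X in _ / X).
have -> : S = S'.
  rewrite /S /S' big_seq [RHS]big_seq; apply: eq_bigr => jl jlw.
  suff -> : u jl.1 jl.2 <= \sum_(jl <- window B t m) `|u jl.1 jl.2| by [].
  apply: le_trans (ler_norm _) _.
  by rewrite (big_rem jl)//= lerDl sumr_ge0.
by rewrite divff// /S' -natr_sum sum1_size size_window pnatr_eq0 -lt0n.
Qed.

Lemma qhat_le z : 1 - alpha <= Fhat B u t m z -> qhat alpha B u t m <= z.
Proof.
move=> pz; apply: ge_inf => //; have [M HM] := Fhat_eq0.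
exists M => x /= px; rewrite leNgt; apply/negP => /HM x0.
by move: px; rewrite x0; have /andP[] := alpha01; lra.
Qed.

Lemma qhat_ge z : Fhat B u t m z < 1 - alpha -> z <= qhat alpha B u t m.
Proof.
move=> zp; apply: lb_le_inf.
  by have [M HM] := Fhat_eq1; exists M; rewrite /= HM; have /andP[] := alpha01; lra.
move=> x /= px; rewrite leNgt; apply/negP => /ltW /Fhat_nondecreasing; lra.
Qed.
End empirical_quantile.

(** * The union bound and finite minima *)

Lemma measure_bigsetU_le d (T : measurableType d) (R : realType) (P : probability T R)
    (I : eqType) (s : seq I) (A : I -> set T) (e : R) :
  (forall i, measurable (A i)) -> (forall i, i \in s -> (P (A i) <= e%:E)%E) ->
  (P (\big[setU/set0]_(i <- s) A i) <= ((size s)%:R * e)%:E)%E.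
Proof.
move=> mA; elim: s => [|i s IH] Ae; first by rewrite big_nil measure0 mul0r.
rewrite big_cons /= -natr1 mulrDl mul1r addrC EFinD.
have mU : measurable (\big[setU/set0]_(i <- s) A i).
  by elim/big_ind: _ => // *; exact: measurableU.
apply: le_trans (@measureU2 _ _ _ P _ _ (mA i) mU) _; apply: leeD.
  by apply: Ae; rewrite mem_head.
by apply: IH => j js; apply: Ae; rewrite inE js orbT.
Qed.

Section min_1_to.
Variables (R : realType) (t : nat) (f : nat -> R).

Lemma min_1_to_le k : (1 <= k <= t)%N -> min_1_to t f <= f k.
Proof. by move=> kt; apply: (@bigmin_inf_seq _ _ _ _ _ k) => //; rewrite mem_index_iota. Qed.

Lemma min_1_to_attained : (1 <= t)%N -> exists2 k, (1 <= k <= t)%N & min_1_to t f = f k.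
Proof.
move=> t1; rewrite /min_1_to big_nat; apply: (big_ind (fun x => exists2 k, (1 <= k <= t)%N & x = f k)) => //.
(* The default value of the minimum is [f 1], which is attained since [1 <= t]. *)
- by exists 1%N; rewrite ?leqnn.
- by move=> x y [k kt ->] [l lt ->]; case: (leP (f k) (f l)); [exists k|exists l].
- by move=> k kt; exists k.
Qed.
End min_1_to.

(** * Comparisons between [psi] at different confidence levels and the final rate *)

Section psi_comparisons.
Variables (R : realType) (alpha : R) (B : nat -> nat) (t m : nat).
Hypothesis alpha01 : 0 < alpha < 1.

Lemma psi_ge0 delta : 0 < delta < 2 -> 0 <= psi alpha B t m delta.
Proof.
move=> /andP[d0 d2]; rewrite /psi addr_ge0// ?mulr_ge0 ?sqrtr_ge0 ?invr_ge0//.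
by rewrite ln_ge0// ler_pdivlMr// mul1r ltW.
Qed.

(** Halving [delta] adds [ln 2] to the logarithm, and [ln 2 <= ln (2 / delta)], so the logarithm at
    most doubles. *)
Lemma psi_half_bounds delta : 0 < delta < 1 ->
  psi alpha B t m delta <= psi alpha B t m (delta / 2) <= 2 * psi alpha B t m delta.
Proof.
move=> /andP[d0 d1]; have /andP[a0 a1] := alpha01.
have ln2 : 0 <= ln 2 :> R by rewrite ln_ge0//; lra.
have ln2d : ln 2 <= ln (2 / delta).
  by rewrite ler_ln ?posrE ?divr_gt0// ler_pdivlMr//; nra.
have e : ln (2 / (delta / 2)) = ln 2 + ln (2 / delta).
  rewrite -lnM ?posrE ?divr_gt0//; congr ln; field; lra.
rewrite /psi e; set x := ln (2 / delta) in ln2d *; set N := (Bwin B t m)%:R : R.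
have N0 : 0 <= N^-1 by rewrite invr_ge0.
have b0 : 0 <= 2 * alpha * (1 - alpha) * N^-1 by rewrite !mulr_ge0//; lra.
have r1 : Num.sqrt (2 * alpha * (1 - alpha) * x / N)
    <= Num.sqrt (2 * alpha * (1 - alpha) * (ln 2 + x) / N).
  by apply: ler_wsqrtr; nra.
have r2 : Num.sqrt (2 * alpha * (1 - alpha) * (ln 2 + x) / N)
    <= 2 * Num.sqrt (2 * alpha * (1 - alpha) * x / N).
  have -> : 2 * Num.sqrt (2 * alpha * (1 - alpha) * x / N)
      = Num.sqrt (2 ^+ 2 * (2 * alpha * (1 - alpha) * x / N)).
    by rewrite [RHS]sqrtrM ?sqr_ge0// sqrtr_sqr ger0_norm.
  by apply: ler_wsqrtr; nra.
have l1 : 4 * x / N <= 4 * (ln 2 + x) / N by rewrite ler_wpM2r//; lra.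
have l2 : 4 * (ln 2 + x) / N <= 2 * (4 * x / N) by rewrite [leRHS]mulrA ler_wpM2r//; lra.
by apply/andP; split; lra.
Qed.

Lemma psi_le_rate delta : 2^-1 <= ln (2 / delta) ->
  psi alpha B t m delta <= 4 * ln (2 / delta) *
    (Num.sqrt (alpha * (1 - alpha) / (Bwin B t m)%:R) + 1 / (Bwin B t m)%:R).
Proof.
move=> x1; have /andP[a0 a1] := alpha01.
rewrite /psi; set x := ln _ in x1 *; set N := (Bwin B t m)%:R : R.
have N0 : 0 <= N^-1 by rewrite invr_ge0.
have b0 : 0 <= alpha * (1 - alpha) * N^-1 by rewrite !mulr_ge0//; lra.
have r1 : Num.sqrt (2 * alpha * (1 - alpha) * x / N)
    <= 2 * x * Num.sqrt (alpha * (1 - alpha) / N).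
  have -> : 2 * x * Num.sqrt (alpha * (1 - alpha) / N)
      = Num.sqrt ((2 * x) ^+ 2 * (alpha * (1 - alpha) / N)).
    by rewrite [RHS]sqrtrM ?sqr_ge0// sqrtr_sqr ger0_norm//; lra.
  (* Here [1 <= 2 * x], hence [2 * x <= (2 * x) ^+ 2]. *)
  apply: ler_wsqrtr.
  have -> : 2 * alpha * (1 - alpha) * x / N = (2 * x) * (alpha * (1 - alpha) / N) by ring.
  by rewrite ler_wpM2r//; nra.
have s0 : 0 <= Num.sqrt (alpha * (1 - alpha) / N) by exact: sqrtr_ge0.
have xs : 0 <= x * Num.sqrt (alpha * (1 - alpha) / N) by rewrite mulr_ge0//; lra.
rewrite div1r; set S := Num.sqrt (alpha * _ / N) in r1 s0 xs *.
set n := N^-1 in N0 *.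
have -> : 4 * x * (S + n) = 5 / 4 * (2 * x * S) + 4 * x * n + 3 / 2 * (x * S) by field.
by lra.
Qed.
End psi_comparisons.

(** * Deterministic transfer from fixed levels to quantiles *)

(* [G] stands for the random empirical CDFs and [H] for the target CDF, inverted
   by the deterministic [z]; the levels [p + e] and [p - e] matter only when they
   lie in ]0, 1[, the bounds being trivial otherwise. *)
Section quantile_transfer.
Variables (R : realType) (p : R) (H z : R -> R) (G : nat -> R -> R) (phi psi : nat -> R).
Hypothesis H_homo : forall x y, x <= y -> H x <= H y.
Hypothesis H01 : forall x, 0 <= H x <= 1.
Hypothesis zP : forall c, 0 < c < 1 -> H (z c) = c.

(** The error of [Fhat_near] at a level at distance [e] from [p]: the CDFs of the window are within
    [phi m] of the level, hence within [phi m + e] of [p]. *)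
Let dev m e := phi m + (4 / 5 * psi m + (phi m + e) / 4).

Definition near_levels m e := forall c, 0 < c < 1 -> `|c - p| = e -> `|G m (z c) - c| < dev m e.

(** If [x] were to the right of [z (p + e)], monotonicity would give [G m x] a value above
    [p + e - dev m e]. *)
Lemma target_le m e x : (forall x y, x <= y -> G m x <= G m y) ->
  0 < p < 1 -> 0 <= e -> near_levels m e -> G m x <= p + e - dev m e -> H x <= p + e.
Proof.
move=> Gh p01 e0 gd Gx; have [pe1|pe1] := leP 1 (p + e).
  by have := H01 x; lra.
have c01 : 0 < p + e < 1 by lra.
rewrite -[leRHS](zP c01); apply: H_homo; rewrite leNgt; apply/negP => /ltW /Gh.
by have := gd _ c01; rewrite addrC addKr ger0_norm// ltr_distl => /(_ erefl); lra.
Qed.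

Lemma target_ge m e x : (forall x y, x <= y -> G m x <= G m y) ->
  0 < p < 1 -> 0 <= e -> near_levels m e -> p - e + dev m e <= G m x -> p - e <= H x.
Proof.
move=> Gh p01 e0 gd Gx; have [pe1|pe1] := leP (p - e) 0.
  by have := H01 x; lra.
have c01 : 0 < p - e < 1 by lra.
rewrite -[leLHS](zP c01); apply: H_homo; rewrite leNgt; apply/negP => /ltW /Gh.
by have := gd _ c01; rewrite addrAC subrr sub0r normrN ger0_norm// ltr_distl => /(_ erefl); lra.
Qed.

Variables (k : nat) (q e : R).
Hypothesis p01 : 0 < p < 1.
Hypothesis e0 : 0 <= e.
Hypothesis q_le : forall x, p <= G k x -> q <= x.
Hypothesis q_ge : forall x, G k x < p -> x <= q.
Hypothesis dev_e : dev k e <= e.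
Hypothesis good_k : near_levels k e.

(** Since [dev k e <= e], the function [G k] exceeds [p] at the point of level [p + e], which
    therefore lies to the right of the quantile. *)
Lemma quantile_le_level : p + e < 1 -> q <= z (p + e).
Proof.
have /andP[p_gt0 p_lt1] := p01; have e_ge0 := e0; have dev_k := dev_e.
move=> pe; have c01 : 0 < p + e < 1 by lra.
apply: q_le; have := good_k c01.
by rewrite addrC addKr ger0_norm// ltr_distl => /(_ erefl); lra.
Qed.

Lemma quantile_ge_level : 0 < p - e -> z (p - e) <= q.
Proof.
have /andP[p_gt0 p_lt1] := p01; have e_ge0 := e0; have dev_k := dev_e.
move=> pe; have c01 : 0 < p - e < 1 by lra.
apply: q_ge; have := good_k c01.
by rewrite addrAC subrr sub0r normrN ger0_norm// ltr_distl => /(_ erefl); lra.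
Qed.

Lemma quantile_target_dev : `|H q - p| <= e.
Proof.
have /andP[p_gt0 p_lt1] := p01; have e_ge0 := e0; have dev_k := dev_e.
have up : H q <= p + e.
  have [pe|pe] := leP 1 (p + e); first by have := H01 q; lra.
  by rewrite -[leRHS]zP; [apply: H_homo; exact: quantile_le_level|lra].
have lo : p - e <= H q.
  have [pe|pe] := leP (p - e) 0; first by have := H01 q; lra.
  by rewrite -[leLHS]zP; [apply: H_homo; exact: quantile_ge_level|lra].
by rewrite ler_distl; lra.
Qed.

(** Window [k] brackets [q] between the points of levels [p - e] and [p + e]; window [i] is then
    evaluated at these same deterministic points. *)
Lemma quantile_window_dev i : (forall x y, x <= y -> G i x <= G i y) ->
  (forall x, 0 <= G i x <= 1) -> 0 <= dev i e -> near_levels i e -> `|G i q - p| <= e + dev i e.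
Proof.
have /andP[p_gt0 p_lt1] := p01; have e_ge0 := e0; have dev_k := dev_e.
move=> Gh G01 d0 good_i.
have up : G i q <= p + e + dev i e.
  have [pe|pe] := leP 1 (p + e); first by have := G01 q; lra.
  have c01 : 0 < p + e < 1 by lra.
  have := good_i _ c01; rewrite addrC addKr ger0_norm// ltr_distl => /(_ erefl).
  by have := Gh _ _ (quantile_le_level pe); lra.
have lo : p - e - dev i e <= G i q.
  have [pe|pe] := leP (p - e) 0; first by have := G01 q; lra.
  have c01 : 0 < p - e < 1 by lra.
  have := good_i _ c01; rewrite addrAC subrr sub0r normrN ger0_norm// ltr_distl => /(_ erefl).
  by have := Gh _ _ (quantile_ge_level pe); lra.
by rewrite ler_distl; lra.
Qed.
End quantile_transfer.

(** * A single event controlling all windows and levels *)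

Section concentration_event.
Context d (T : measurableType d) (R : realType) (P : probability T R).
Variables (t : nat) (alpha delta : R) (B : nat -> nat) (F : nat -> R -> R).
Variable u : nat -> nat -> {RV P >-> R}.
Hypothesis alpha01 : 0 < alpha < 1.
Hypothesis delta02 : 0 < delta < 2.
Hypothesis B_gt0 : forall j, (1 <= j <= t)%N -> (1 <= B j)%N.
Hypothesis cdf_u : forall j l, (1 <= j <= t)%N -> (1 <= l <= B j)%N ->
     forall x, cdf (u j l) x = (F j x)%:E.
Hypothesis u_indep : mutually_independent P
    (fun jl : nat * nat => (1 <= jl.1 <= t)%N /\ (1 <= jl.2 <= B jl.1)%N)
    (fun jl => (u jl.1 jl.2 : T -> R)).
Variable z : R -> R.
Hypothesis zP : forall c, 0 < c < 1 -> F t (z c) = c.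

Lemma concentration_event (levels : seq R) :
  exists E : set T, [/\ measurable E,
    (1 - (t%:R * (size levels)%:R * delta)%:E <= P E)%E &
    forall w, E w -> forall m e, (1 <= m <= t)%N ->
      1 - alpha + e \in levels -> 1 - alpha - e \in levels ->
      near_levels (1 - alpha) z (Fhat B (fun j l => u j l w) t) (phi F t)
        (fun m => psi alpha B t m delta) m e].
Proof.
set p := 1 - alpha.
(* Levels outside ]0, 1[ need not be attained by the target CDF, so they contribute no bad event. *)
pose Bad (mc : nat * R) := if 0 < mc.2 < 1
  then deviates t alpha delta B F u mc.1 (z mc.2) (phi F t mc.1 + `|mc.2 - p|) else set0.
pose idx := [seq (m, c) | m <- iota 1 t, c <- levels].
have mBad mc : measurable (Bad mc) by rewrite /Bad; case: ifP => // _; exact: measurable_deviates.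
have F01 j y : (1 <= j <= t)%N -> 0 <= F j y <= 1 by move=> jt; exact: (cdf_F_01 B_gt0 cdf_u).
have PBad mc : mc \in idx -> (P (Bad mc) <= delta%:E)%E.
  case/allpairsP => -[m c] /= [mt _ ->]; rewrite mem_iota ltnS in mt.
  rewrite /Bad /=; case: ifP => [c01|_]; last by rewrite measure0 lee_fin; case/andP: delta02 => /ltW.
  apply: deviates_le => // j jt tjm.
  have -> : F j (z c) - (1 - alpha) = (F j (z c) - F t (z c)) + (c - p) by rewrite zP// /p; ring.
  apply: le_trans (ler_normD _ _) _; rewrite lerD2r; apply: phi_ge => //.
  by case/andP: mt.
have mU : measurable (\big[setU/set0]_(mc <- idx) Bad mc).
  by elim/big_ind: _ => // *; exact: measurableU.
exists (~` \big[setU/set0]_(mc <- idx) Bad mc); split; first exact: measurableC.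
  rewrite probability_setC//; apply: leeB => //.
  by apply: le_trans (measure_bigsetU_le mBad PBad) _; rewrite size_allpairs size_iota natrM.
move=> w Ew m e mt ple pge c c01 ce.
have cl : c \in levels.
  have [cp|cp] := leP 0 (c - p).
    by have -> : c = p + e by rewrite -ce ger0_norm//; ring.
  by have -> : c = p - e by rewrite -ce ltr0_norm//; ring.
have nBad : ~ Bad (m, c) w.
  move=> bw; apply: Ew; rewrite -bigcup_seq; exists (m, c) => //=.
  by apply/allpairsP; exists (m, c); rewrite mem_iota ltnS.
rewrite -ce; apply: Fhat_near => //.
  move=> j jt tjm; rewrite -[X in _ - X](zP c01).
  by apply: phi_ge => //; case/andP: mt.
by move: nBad; rewrite /Bad /= c01.
Qed.
End concentration_event.

(** * The oracle inequality on the concentration event *)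

Section oracle_inequality.
Variables (R : realType) (alpha delta : R) (B : nat -> nat) (F : nat -> R -> R).
Variables (u : nat -> nat -> R) (t : nat) (z : R -> R).
Hypothesis alpha01 : 0 < alpha < 1.
Hypothesis delta01 : 0 < delta < 1.
Hypothesis B_gt0 : forall j, (1 <= j <= t)%N -> (1 <= B j)%N.
Hypothesis Ft_homo : forall x y, x <= y -> F t x <= F t y.
Hypothesis Ft01 : forall x, 0 <= F t x <= 1.
Hypothesis zP : forall c, 0 < c < 1 -> F t (z c) = c.

Let p := 1 - alpha.
Let psi2 m := psi alpha B t m (delta / 2).
Let D k := phi F t k + psi2 k.
Let q k := qhat alpha B u t k.

Hypothesis good_m : forall m k, (1 <= m <= t)%N -> (1 <= k <= t)%N ->
  near_levels p z (Fhat B u t) (phi F t) psi2 m (2 * D k) /\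
  near_levels p z (Fhat B u t) (phi F t) psi2 m (13 * D k).

Let psi2_ge0 m : 0 <= psi2 m.
Proof. by apply: psi_ge0; have /andP[? ?] := delta01; lra. Qed.

Let p01 : 0 < p < 1.
Proof. by rewrite /p; have /andP[? ?] := alpha01; lra. Qed.

(** The radius [2 * D k] qualifies because the deviation there is
    [7 / 4 * phi F t k + 13 / 10 * psi2 k]. *)
Lemma qhat_dev k : (1 <= k <= t)%N -> `|F t (q k) - p| <= 2 * D k.
Proof.
move=> kt; have phik := phi_ge0 F t k; have psik := psi2_ge0 k.
have N0 := Bwin_gt0 B_gt0 kt; have [g2 _] := good_m kt kt.
apply: (quantile_target_dev Ft_homo Ft01 zP p01 _ _ _ _ g2).
- by rewrite /D; lra.
- by move=> x; exact: qhat_le.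
- by move=> x; exact: qhat_ge.
- by rewrite /D; lra.
Qed.

Lemma Fhat_qhat_dev i k : (1 <= i <= k)%N -> (k <= t)%N ->
  `|Fhat B u t i (q k) - p| <= 4 * D k + 4 / 5 * psi2 i.
Proof.
move=> /andP[i1 ik] kt0.
have kt : (1 <= k <= t)%N by rewrite kt0 (leq_trans i1).
have it : (1 <= i <= t)%N by rewrite i1 (leq_trans ik).
have phik := phi_ge0 F t k; have psik := psi2_ge0 k.
have phii := phi_ge0 F t i; have psii := psi2_ge0 i; have phiik := phi_le F t ik.
have N0 := Bwin_gt0 B_gt0 kt; have Ni0 := Bwin_gt0 B_gt0 it.
have [gk _] := good_m kt kt; have [gi _] := good_m it kt.
apply: le_trans (quantile_window_dev p01 _ _ _ _ gk _ _ _ gi) _.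
- by rewrite /D; lra.
- by move=> x; exact: qhat_le.
- by move=> x; exact: qhat_ge.
- by rewrite /D; lra.
- by move=> x y; exact: Fhat_nondecreasing.
- by move=> x; exact: Fhat_01.
- by rewrite /D; lra.
by rewrite /D; lra.
Qed.

Lemma phihat_le k : (1 <= k <= t)%N -> phihat alpha B u t k delta <= 2 * D k.
Proof.
move=> /andP[k1 kt]; have phik := phi_ge0 F t k; have psik := psi2_ge0 k.
suff h : \big[Num.max/0]_(1 <= i < k.+1)
    Num.max 0 (`|Fhat B u t i (q k) - p| - (6 / 5 * psi2 k + 4 / 5 * psi2 i)) <= 4 * D k.
  have D0 : 0 <= D k by rewrite /D; lra.
  by rewrite /phihat; move: h; rewrite /psi2 -/p; set M := \big[_/_]_(_ <= _ < _) _; lra.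
rewrite big_nat; apply: bigmax_le => [|i]; first by rewrite /D; lra.
rewrite ltnS => ik; rewrite ge_max; have := Fhat_qhat_dev ik kt.
by rewrite /D => h; apply/andP; split; lra.
Qed.

(** Inverts the definition of [phihat], whose maximum includes the index [i]. *)
Lemma Fhat_qhat_dev_le_phihat i k : (1 <= i <= k)%N ->
  `|Fhat B u t i (q k) - p|
  <= 12 / 5 * phihat alpha B u t k delta + (6 / 5 * psi2 k + 4 / 5 * psi2 i).
Proof.
move=> ik; rewrite /phihat.
set M := \big[Num.max/0]_(_ <= _ < _) _.
suff : `|Fhat B u t i (q k) - p| - (6 / 5 * psi2 k + 4 / 5 * psi2 i) <= M by lra.
apply: (@bigmax_sup_seq _ _ _ _ _ i) => //; first by rewrite mem_index_iota ltnS.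
by rewrite le_max lexx orbT.
Qed.

Let obj k := phihat alpha B u t k delta + psi alpha B t k delta.

Lemma oracle_inequality khat k : (1 <= khat <= t)%N -> (1 <= k <= t)%N ->
  obj khat <= obj k -> `|F t (q khat) - p| <= 28 * (phi F t k + psi alpha B t k delta).
Proof.
move=> ht kt oh.
have phik := phi_ge0 F t k; have psik := psi2_ge0 k.
have phih := phi_ge0 F t khat; have psih := psi2_ge0 khat.
have phk := phihat_le kt.
have /andP[b1 b2] := psi_half_bounds B t k alpha01 delta01.
have /andP[c1 c2] := psi_half_bounds B t khat alpha01 delta01.
have ph0 : 0 <= phihat alpha B u t khat delta by rewrite mulr_ge0// bigmax_ge_id.
have okh : phihat alpha B u t khat delta + psi alpha B t khat delta <= 3 * D k.
  by move: oh; rewrite /obj /D /psi2 in phk b1 *; lra.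
(* [D k] is at most [phi F t k + 2 * psi alpha B t k delta], so 14 doubles to 28. *)
suff : `|F t (q khat) - p| <= 14 * D k by rewrite /D /psi2; lra.
have [hk|kh] := leqP khat k.
  (* Here [2 * D khat] is at most [2 * phi F t k] plus [4 * psi alpha B t khat delta], and the
     latter is at most [12 * D k] by [okh]. *)
  have := qhat_dev ht; have := phi_le F t hk.
  by move: okh; rewrite /D /psi2; lra.
(* The weight 6/5 on [psi2 khat] is at most 12/5 on [psi] at [delta], so [okh] bounds the sum by
   36/5 + 4/5 = 8 times [D k]. *)
have Gdev : `|Fhat B u t k (q khat) - p| <= 8 * D k.
  have := @Fhat_qhat_dev_le_phihat k khat; rewrite (ltnW kh); case/andP: kt => -> _ /(_ isT).
  by move: okh psih psik; rewrite /D /psi2; lra.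
have [_ g] := good_m kt kt.
have Gh x y : x <= y -> Fhat B u t k x <= Fhat B u t k y by exact: Fhat_nondecreasing.
(* At radius [13 * D k] the deviation is at most [5 * D k], which leaves the margin [8 * D k] of
   [Gdev]. *)
have e0 : 0 <= 13 * D k by rewrite /D; lra.
move: Gdev; rewrite ler_distl => /andP[Glo Gup].
have up := target_le Ft_homo Ft01 zP Gh p01 e0 g (x := q khat).
have lo := target_ge Ft_homo Ft01 zP Gh p01 e0 g (x := q khat).
have {}up := up ltac:(move: Gup; rewrite /D; lra).
have {}lo := lo ltac:(move: Glo; rewrite /D; lra).
by rewrite ler_distl; move: psik up lo; rewrite /D; lra.
Qed.
End oracle_inequality.

Theorem theorem3 :
  exists C : nat,
  forall (d : measure_display) (T : measurableType d) (R : realType)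
    (P : probability T R) (t : nat) (alpha delta : R)
    (B : nat -> nat) (F : nat -> R -> R)
    (u : nat -> nat -> {RV P >-> R}) (khat : T -> nat),
  (1 <= t)%N ->
  0 < alpha < 1 ->
  0 < delta < 1 ->
  (forall j, (1 <= j <= t)%N -> (1 <= B j)%N) ->
  (* Q_j has continuous CDF F_j, and u_{j,l} ~ Q_j *)
  (forall j, (1 <= j <= t)%N -> continuous (F j)) ->
  (forall j l, (1 <= j <= t)%N -> (1 <= l <= B j)%N ->
     forall x, cdf (u j l) x = (F j x)%:E) ->
  (* independent datasets of i.i.d. samples: all u_{j,l} mutually independent *)
  mutually_independent P
    (fun jl : nat * nat => (1 <= jl.1 <= t)%N /\ (1 <= jl.2 <= B jl.1)%N)
    (fun jl => (u jl.1 jl.2 : T -> R)) ->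
  let delta' := delta / (4 * (t ^ 2)%:R) in
  let obj (w : T) (k : nat) :=
    phihat alpha B (fun j l => u j l w) t k delta' + psi alpha B t k delta' in
  (* khat w is an argmin over k in {1,...,t} of obj w k *)
  (forall w, (1 <= khat w <= t)%N /\
             forall k, (1 <= k <= t)%N -> obj w (khat w) <= obj w k) ->
  let L := ln (2 / delta') in
  exists E : set T, measurable E /\ (P E >= 1 - delta%:E)%E /\
  forall w, E w ->
    `|F t (qhat alpha B (fun j l => u j l w) t (khat w)) - (1 - alpha)|
      <= C%:R * L * min_1_to t (fun k => phi F t k + psi alpha B t k delta')
    /\ min_1_to t (fun k => phi F t k + psi alpha B t k delta')
      <= C%:R * L * min_1_to t (fun k => phi F t k
             + Num.sqrt (alpha * (1 - alpha) / (Bwin B t k)%:R) + 1 / (Bwin B t k)%:R).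
Proof.
(* Twice the oracle constant 28, since [L] is at least 1/2. *)
exists 56%N => d T R P t alpha delta B F u khat t1 alpha01 delta01 B_gt0 Fc cdf_u u_indep.
move=> delta' obj khatP L.
have delta'E : delta' = delta / (4 * (t ^ 2)%:R) by [].
have /andP[d0 d1] := delta01.
have t20 : 1 <= (t ^ 2)%:R :> R by rewrite ler1n expn_gt0 t1.
have delta'01 : 0 < delta' < 1.
  by rewrite delta'E divr_gt0 ?ltr_pdivrMr ?mul1r//=; lra.
clearbody delta'.
have [d'0 d'1] := andP delta'01.
have tt : (1 <= t <= t)%N by rewrite t1 leqnn.
have F01 x : 0 <= F t x <= 1 := cdf_F_01 B_gt0 cdf_u x tt.
have B11 : (1 <= 1 <= B t)%N by rewrite B_gt0.
have Fhomo x y : x <= y -> F t x <= F t y.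
  by move=> xy; have := cdf_nondecreasing (u t 1) xy; rewrite !cdf_u// lee_fin.
have [z zP] : {z : R -> R | forall c, 0 < c < 1 -> F t (z c) = c}.
  (* The range condition is inside the existential so that choice yields a total function [z]. *)
  have zex c : exists x, 0 < c < 1 -> F t x = c.
    have [c01|] := boolP (0 < c < 1); last by exists 0.
    have [x xc] := cdf_surjective (Fc _ tt) (cdf_u _ _ tt B11) c01.
    by exists x.
  by exists (fun c => projT1 (cid (zex c))) => c; case: cid.
pose D k := phi F t k + psi alpha B t k (delta' / 2).
pose levels := [seq (1 - alpha + a * D k) | k <- iota 1 t, a <- [:: 2; -2; 13; -13 : R]].
have levelsP k a : (1 <= k <= t)%N -> a \in [:: 2; -2; 13; -13 : R] ->
    1 - alpha + a * D k \in levels.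
  by move=> kt al; apply/allpairsP; exists (k, a); rewrite mem_iota ltnS.
(* Concentration is taken at [delta' / 2], the level at which [phihat] evaluates [psi]. *)
have d'02 : 0 < delta' / 2 < 2 by lra.
have [E [mE PE goodE]] :=
  concentration_event alpha01 d'02 B_gt0 cdf_u u_indep zP levels.
have L_ge : 2^-1 <= L.
  (* From [ln y <= y - 1] at [y = delta' / 2], one gets [L >= 1 - delta' / 2]. *)
  have := @le_ln1Dx R (delta' / 2 - 1); rewrite [1 + _]addrC subrK => /(_ ltac:(lra)).
  have {1}-> : delta' / 2 = (2 / delta')^-1 by rewrite invf_div.
  rewrite lnV ?posrE ?divr_gt0// -/L => ?.
  have : delta' <= 4^-1 by rewrite delta'E ler_pdivrMr// ?mulr_gt0//; lra.
  by lra.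
have rate_ge0 k : 0 <= Num.sqrt (alpha * (1 - alpha) / (Bwin B t k)%:R) + 1 / (Bwin B t k)%:R :> R.
  by rewrite addr_ge0// sqrtr_ge0.
exists E; split => //; split.
  apply: le_trans PE; rewrite leeB// lee_fin size_allpairs size_iota natrM /= delta'E natrX.
  (* There are t windows and 4t levels, each failing with probability at most [delta' / 2]. *)
  have -> : t%:R * (t%:R * 4%:R) * (delta / (4 * t%:R ^+ 2) / 2) = delta / 2.
    by field; rewrite pnatr_eq0 -lt0n.
  by lra.
move=> w Ew; split.
  have [k kt ->] := min_1_to_attained (fun k => phi F t k + psi alpha B t k delta') t1.
  have [kh_t kh_min] := khatP w.
  have psi0 : 0 <= phi F t k + psi alpha B t k delta'.
    by rewrite addr_ge0 ?phi_ge0// psi_ge0//; lra.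
  apply: (@le_trans _ _ (28 * (phi F t k + psi alpha B t k delta'))); last by nra.
  apply: (oracle_inequality alpha01 delta'01 B_gt0 Fhomo F01 zP _ kh_t kt (kh_min k kt)).
  by move=> m l mt lt; split; apply: goodE => //; rewrite -?mulNr; apply: levelsP; rewrite // !inE eqxx ?orbT.
have [k kt ->] := min_1_to_attained (fun k => phi F t k
             + Num.sqrt (alpha * (1 - alpha) / (Bwin B t k)%:R) + 1 / (Bwin B t k)%:R) t1.
apply: le_trans (min_1_to_le _ kt) _.
have := psi_le_rate B t k alpha01 L_ge; have := phi_ge0 F t k; have := rate_ge0 k.
rewrite -/L -addrA; set r := _ + _ / _ => r0 phi0 pr.
have := mulr_ge0 (_ : 0 <= L) r0; nra.
Qed.
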